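(* Fix $p\in(0,1)$ and let $A\subset\mathbb{N}$ be a random subset distributed as $\mathbb{N}_p$, i.e. each $n\in\mathbb{N}$ is included in $A$ independently with probability $p$. Then with probability $1$ the following holds: for every integer $L\ge 1$ there exist integers $x_1<\cdots<x_L$ in $\mathbb{N}$ such that \[ \operatorname{FP}(x_1,\dots,x_L)\subset A . \]
   Context: $\mathbb{N}=\{1,2,3,\dots\}$. For $x_1,\dots,x_L\in\mathbb{N}$, the finite product set is \[ \operatorname{FP}(x_1,\dots,x_L):=\Big\{\prod_{i\in F}x_i:\ \varnothing\ne F\subset\{1,\dots,L\}\Big\}. \] $\mathbb{N}_p$ denotes the law of the random subset of $\mathbb{N}$ obtained by including each $n\in\mathbb{N}$ independently with probability $p$. *)

(* Defs.v *)
From HB Require Import structures.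
From mathcomp Require Import all_boot all_order all_algebra finmap.
From mathcomp Require Import all_classical all_reals all_analysis.

Set Implicit Arguments.
Unset Strict Implicit.
Unset Printing Implicit Defensive.

Import Order.TTheory GRing.Theory Num.Theory.
Import numFieldNormedType.Exports.

Local Open Scope classical_set_scope.
Local Open Scope ring_scope.

Definition posnat : set nat := [set n | (1 <= n)%N].

(* The indices 1, ..., L are shifted to 0, ..., L - 1. *)
Definition FP (L : nat) (x : 'I_L -> nat) : set nat :=
  [set (\prod_(i in F) x i)%N | F in [set F : {set 'I_L} | F != finset.set0]].

Definition independent_events (d : measure_display) (T : measurableType d)
    (R : realType) (P : probability T R) (I : choiceType) (D : set I)
    (E : I -> set T) : Prop :=
  (forall i, D i -> measurable (E i)) /\
  (forall J : {fset I}, [set` J] `<=` D ->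
     P (\bigcap_(i in [set` J]) E i) = (\prod_(i <- J) P (E i))%E).

(* These conditions determine the law of A on the sigma-algebra generated by
   the events {n in A}, namely the product Bernoulli(p) law. *)
Definition random_subset (d : measure_display) (T : measurableType d)
    (R : realType) (P : probability T R) (p : R) (A : T -> set nat) : Prop :=
  [/\ forall w, A w `<=` posnat,
      independent_events P posnat (fun n => [set w | A w n])
    & forall n, posnat n -> P [set w | A w n] = p%:E].

(* Main.v *)
(** The sets [FP(x_1, ..., x_L)] with [x_i = 2 ^ (B ^ k * i)] are pairwise
    disjoint for [k = 0, 1, 2, ...] as soon as [B > L ^ 2], since the exponents
    occurring in the [k]-th one lie in [[B ^ k, B ^ (k + 1))].  Hence the events
    that [A] contains the [k]-th set are independent, and their probabilities
    are bounded below by [p ^ (2 ^ L)], so almost surely one of them occurs. *)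

Require Import Defs.
From HB Require Import structures.
From mathcomp Require Import all_boot all_order all_algebra finmap.
From mathcomp Require Import all_classical all_reals all_analysis.

Set Implicit Arguments.
Unset Strict Implicit.
Unset Printing Implicit Defensive.

Import Order.TTheory GRing.Theory Num.Theory.
Import numFieldNormedType.Exports.

Local Open Scope classical_set_scope.
Local Open Scope ring_scope.

Section random_subset.
Context (R : realType) (d : measure_display) (T : measurableType d).
Context (P : probability T R) (p : R) (A : T -> set nat).
Hypothesis Arandom : random_subset P p A.

Definition contains (J : {fset nat}) : set T :=
  \bigcap_(n in [set` J]) [set w | A w n].

Lemma measurable_contains (J : {fset nat}) :
  [set` J] `<=` posnat -> measurable (contains J).
Proof.
case: Arandom => _ [mA _] _ Jpos.
by apply: fin_bigcap_measurable => // n /Jpos; apply: mA.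
Qed.

Lemma containsU (J K : {fset nat}) :
  contains (J `|` K)%fset = contains J `&` contains K.
Proof. by rewrite /contains set_fsetU bigcap_setU. Qed.

Lemma probability_contains (J : {fset nat}) :
  [set` J] `<=` posnat -> P (contains J) = (p ^+ #|` J|)%:E.
Proof.
case: Arandom => _ [_ indA] PA Jpos; rewrite indA//.
rewrite (eq_big_seq (fun=> p%:E)); last by move=> n nJ; exact/PA/Jpos.
by rewrite prodEFin big_const_seq count_predT iter_mulr_1.
Qed.

Section disjoint_family.
Variable S : nat -> {fset nat}.
Hypothesis Spos : forall k, [set` S k] `<=` posnat.
Hypothesis Sdisj : forall j k, j != k -> [disjoint S j & S k]%fset.

Definition avoids (K : nat) : set T :=
  \big[setI/setT]_(k < K) ~` contains (S k).

Lemma measurable_avoids (K : nat) : measurable (avoids K).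
Proof.
apply: bigsetI_measurable => k _.
exact/measurableC/measurable_contains.
Qed.

(* The extra event [contains J] makes the induction on [K] go through using
   only the probabilities of the events [contains _]. *)
Lemma probability_avoids_contains (K : nat) (J : {fset nat}) :
  [set` J] `<=` posnat -> (forall k, (k < K)%N -> [disjoint J & S k]%fset) ->
  P (avoids K `&` contains J) =
    ((\prod_(k < K) (1 - p ^+ #|` S k|)) * p ^+ #|` J|)%:E.
Proof.
elim: K J => [|K IH] J Jpos Jdisj.
  by rewrite /avoids !big_ord0 setTI mul1r probability_contains.
have mJ := measurable_contains Jpos; have mS := measurable_contains (Spos (k := K)).
have JSpos : [set` (J `|` S K)%fset] `<=` posnat.
  by rewrite set_fsetU => n [/Jpos|/Spos].
have -> : avoids K.+1 `&` contains J =
    (avoids K `&` contains J) `\` contains (S K).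
  by rewrite /avoids big_ord_recr/= setIAC setDE.
have mAJ : measurable (avoids K `&` contains J).
  exact: measurableI (measurable_avoids K) mJ.
(* Both terms of this difference fall under the induction hypothesis, the second one with [J]
   enlarged by [S K]. *)
have -> : P (avoids K `&` contains J `\` contains (S K)) =
    (P (avoids K `&` contains J) - P (avoids K `&` contains (J `|` S K)%fset))%E.
  by rewrite containsU setIA measureD ?ltey_eq ?fin_num_measure.
rewrite !IH//; last 2 first.
- move=> k kK; rewrite fdisjointUX Jdisj ?Sdisj//; last exact: ltnW.
  by rewrite gtn_eqF.
- by move=> k kK; apply: Jdisj; exact: ltnW.
have -> : #|` (J `|` S K)%fset| = (#|` J| + #|` S K|)%N.
  by apply/eqP; rewrite (leq_card_fsetU J (S K)).2 Jdisj.
by rewrite -EFinB big_ord_recr/= exprD -mulrA -mulrBr mulrBl mul1r [X in _ - X]mulrC.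
Qed.

(** The event that no [S k] is contained lies in [avoids K] for every [K]. The uniform bound [M]
    keeps each factor of the probability of [avoids K] at most [1 - p ^+ M < 1], so the product
    tends to 0. *)
Lemma ae_contains_some (M : nat) : 0 < p -> p < 1 ->
  (forall k, (#|` S k| <= M)%N) ->
  {ae P, forall w, exists k, contains (S k) w}.
Proof.
move=> p0 p1 SM.
pose N := \bigcap_k ~` contains (S k).
have mN : measurable N.
  by apply: bigcapT_measurable => k; exact/measurableC/measurable_contains.
exists N; split=> //; last by move=> w /= /forallNP wN k _; exact: wN.
have q01 : 0 <= 1 - p ^+ M < 1.
  by rewrite subr_ge0 exprn_ile1 ?ltW//= ltrBlDr ltrDl exprn_gt0.
have PN K : (P N <= ((1 - p ^+ M) ^+ K)%:E)%E.
  apply: (@le_trans _ _ (P (avoids K))).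
    apply: le_measure; rewrite ?inE//; first exact: measurable_avoids.
    by rewrite /avoids -(bigcap_mkord _ (fun k => ~` contains (S k))) => w wN k _; exact: wN.
  (* With [J] empty, [contains J] is the whole space. *)
  have := @probability_avoids_contains K fset0.
  rewrite /contains set_fset0 bigcap_set0 setIT cardfs0 expr0 mulr1 => ->//; last first.
    by move=> k _; exact: fdisjoint0X.
  rewrite lee_fin -[X in _ ^+ X](card_ord K) -prodr_const.
  apply: ler_prod => k _; rewrite subr_ge0 lerD2l lerN2.
  by rewrite exprn_ile1 ?ler_wiXn2l// ltW.
apply/eqP; rewrite eq_le measure_ge0 andbT.
have cvg0 : ((1 - p ^+ M) ^+ K)%:E @[K --> \oo] --> 0%E.
  apply: cvg_EFin; first exact: nearW.
  by apply: cvg_expr; case/andP: q01 => q0 q1; rewrite ger0_norm.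
by apply: cvge_ge cvg0; exact: nearW PN.
Qed.

End disjoint_family.
End random_subset.

Section product_blocks.
Variable L : nat.

(** Adding 2 rather than 1 keeps the base at least 2 when [L = 0], as [trunc_log] requires. *)
Definition block_base : nat := (L ^ 2).+2.
Definition block (k : nat) (i : 'I_L) : nat := (2 ^ (block_base ^ k * i.+1))%N.

Definition block_product (k : nat) (F : {set 'I_L}) : nat :=
  \prod_(i in F) block k i.

Definition block_products (k : nat) : {fset nat} :=
  [fset block_product k F | F in predC1 finset.set0]%fset.

(** The exponent of 2 in [n] is [block_base ^ k * s], where [s] is the sum of [i.+1] over [F]. Since
    [1 <= s <= L ^ 2 < block_base], the index [k] can be read off from [n], which gives
    disjointness. *)
Lemma block_products_log (k n : nat) : n \in block_products k ->
  (0 < n)%N /\ trunc_log block_base (logn 2 n) = k.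
Proof.
move=> /imfsetP[F /=]; rewrite inE => /finset.set0Pn[i0 i0F] ->.
rewrite /block_product /block -expn_sum expn_gt0 pfactorK//; split=> //.
rewrite -big_distrr/=; apply: trunc_log_eq => //.
rewrite leq_pmulr; last by rewrite (bigD1 i0).
rewrite expnSr ltn_pmul2l ?expn_gt0// ltnS /=.
(* Each summand [i.+1] is at most [L], and [F] has at most [L] elements: [L * L] is written as a sum
   over all indices, and those outside [F] are dropped. *)
apply/leqW; rewrite -mulnn -[X in (_ <= X * _)%N]card_ord -sum_nat_const.
rewrite [X in (_ <= X)%N](bigID (mem F))/=.
by apply: leq_trans (leq_addr _ _); apply: leq_sum => i _; exact: ltn_ord.
Qed.

Lemma block_products_disjoint (j k : nat) :
  j != k -> [disjoint block_products j & block_products k]%fset.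
Proof.
move=> jk; apply/fdisjointP => n /block_products_log[_ nj].
by apply/negP => /block_products_log[_ nk]; rewrite -nj -nk eqxx in jk.
Qed.

(** There is at most one product per subset; distinct subsets may share a product, as [1 + 2 = 3] in
    the exponents shows. *)
Lemma card_block_products (k : nat) : (#|` block_products k| <= 2 ^ L)%N.
Proof.
apply: leq_trans (leq_imfset_card _ _ _) _ => /=.
rewrite -cardE -[X in (_ <= 2 ^ X)%N]card_ord -cardsT -card_powerset powersetT.
by rewrite cardsT max_card.
Qed.

End product_blocks.

Theorem theoremB (R : realType) (d : measure_display) (T : measurableType d)
    (P : probability T R) (p : R) (A : T -> set nat) :
  0 < p -> p < 1 -> random_subset P p A ->
  {ae P, forall w, forall L : nat, (1 <= L)%N ->
    exists x : 'I_L -> nat,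
      [/\ forall i : 'I_L, posnat (x i),
          forall i j : 'I_L, (i < j)%N -> (x i < x j)%N
        & FP x `<=` A w]}.
Proof.
(* A countable intersection of almost sure events is almost sure, so [L] may be fixed first. *)
move=> p0 p1 Arandom; apply/ae_foralln => L.
have := @ae_contains_some _ _ _ P p A Arandom (block_products L) _
  (@block_products_disjoint L) (2 ^ L)%N p0 p1 (@card_block_products L).
have pos k : [set` block_products L k] `<=` posnat.
  by move=> n /block_products_log[].
move=> /(_ pos); apply: filterS => w [k wk] _; exists (block k); split.
- by move=> i; rewrite /posnat/= expn_gt0.
- by move=> i j ij; rewrite ltn_exp2l// ltn_pmul2l ?expn_gt0.
- move=> _ [F /= F0 <-]; apply: wk => /=.
  by apply/imfsetP; exists F => //=; rewrite inE.
Qed.
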